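(* Let $\mathcal{F}$ be the family of finite hypergraphs of VC-dimension 1. Then: (i) for every integer $r\ge 1$, every $H\in\mathcal{F}$ all of whose hyperedges have at least $r$ vertices satisfies $\mathsf{p}(H)\ge\lceil r/2\rceil$, and some such $H\in\mathcal{F}$ has $\mathsf{p}(H)=\lceil r/2\rceil$; (ii) for every integer $\delta\ge 1$, every $H\in\mathcal{F}$ with minimum degree at least $\delta$ satisfies $\mathsf{p}'(H)\ge\lceil\delta/2\rceil$, and some such $H\in\mathcal{F}$ has $\mathsf{p}'(H)=\lceil\delta/2\rceil$.
   Context: A hypergraph $H=(V,\mathcal{E})$ has finite vertex set $V$ and a finite multiset $\mathcal{E}$ of subsets of $V$. A set $S\subseteq V$ is shattered if $\{S\cap E: E\in\mathcal{E}\}$ is the set of all subsets of $S$; the VC-dimension of $H$ is the largest size of a shattered set. The degree of a vertex is the number of hyperedges containing it. A polychromatic $k$-colouring is a map $V\to\{1,\dots,k\}$ such that every hyperedge contains a vertex of every colour; $\mathsf{p}(H)$ is the maximum such $k$. A set cover is a subfamily of $\mathcal{E}$ with union $V$; $\mathsf{p}'(H)$ is the maximum $k$ such that $\mathcal{E}$ can be partitioned into $k$ set covers. *)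

(* Defs.v *)
From mathcomp Require Import all_boot.

Set Implicit Arguments.
Unset Strict Implicit.
Unset Printing Implicit Defensive.

(* The multiset of hyperedges is a family indexed by a finite type: [edge]
   need not be injective, and equal hyperedges with distinct indices count
   separately (in degrees and in partitions into set covers). *)
Record hypergraph : Type := Hypergraph {
  vertex : finType;
  edge_index : finType;
  edge : edge_index -> {set vertex}
}.

Definition shattered (H : hypergraph) (S : {set vertex H}) : bool :=
  [set S :&: edge e | e : edge_index H] == powerset S.

(* If H has no hyperedge, then no set (not even set0) is shattered, and the
   value is 0 by convention. *)
Definition vc_dim (H : hypergraph) : nat :=
  \max_(S : {set vertex H} | shattered S) #|S|.

Definition degree (H : hypergraph) (v : vertex H) : nat :=
  #|[set e : edge_index H | v \in edge e]|.

Definition polychromatic (H : hypergraph) (k : nat) (c : vertex H -> 'I_k) :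
    Prop :=
  forall (e : edge_index H) (i : 'I_k), exists2 v, v \in edge e & c v = i.

Definition set_cover (H : hypergraph) (C : {set edge_index H}) : bool :=
  \bigcup_(e in C) edge e == [set: vertex H].

(* [partition] requires nonempty blocks; this only matters if H has no vertex,
   since otherwise every set cover is nonempty. *)
Definition cover_decomposable (H : hypergraph) (k : nat) : Prop :=
  exists P : {set {set edge_index H}},
    [/\ partition P [set: edge_index H],
        #|P| = k
      & forall C, C \in P -> set_cover C].

Definition is_maximum (P : nat -> Prop) (m : nat) : Prop :=
  P m /\ forall k, P k -> k <= m.

(* p(H) and p'(H) are given by their graphs, as the maximum need not exist for
   an arbitrary H (without hyperedges, every k >= 1 admits a polychromatic
   k-colouring). *)
Definition is_polychromatic_number (H : hypergraph) (m : nat) : Prop :=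
  is_maximum (fun k => exists c : vertex H -> 'I_k, polychromatic c) m.

Definition is_cover_decomposition_number (H : hypergraph) (m : nat) : Prop :=
  is_maximum (cover_decomposable H) m.

(* Main.v *)
(** A minimal transversal X of a family of sets has, for each x in X, a private
    set meeting X exactly in x.  If three points of X lay in one hyperedge, this
    hyperedge and the private hyperedges of the three points would shatter two
    of them; so removing X costs each hyperedge at most 2 points.  Repeating
    this gives k disjoint transversals as soon as all hyperedges have 2k - 1
    points.  For set covers the argument is run on the dual family, where X only
    has to hit the inclusion-minimal sets.  The family of complements of
    singletons shows that both bounds are sharp. *)

Require Import Defs.
From mathcomp Require Import all_boot.

Set Implicit Arguments.
Unset Strict Implicit.
Unset Printing Implicit Defensive.

(** * Disjoint transversals in a family of sets *)

Section Transversals.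

Variables (T I : finType) (A : I -> {set T}).

(** Dropping [x] from an inclusion-minimal hitting set leaves some selected set unhit, and that set
    is private to [x]. The predicate [Q] allows hitting only part of the family, as the dual case
    requires. *)
Lemma minimal_transversal (Q : pred I) (F : {set T}) :
    (forall i, Q i -> A i :&: F != set0) ->
  exists X : {set T},
    [/\ X \subset F,
        forall i, Q i -> exists2 x, x \in X & x \in A i
      & forall x, x \in X ->
          exists2 i, Q i & forall y, y \in X -> (y \in A i) = (y == x)].
Proof.
move=> hitF; pose hit (X : {set T}) := [forall (i | Q i), A i :&: X != set0].
have hF : hit F by apply/forall_inP.
have [X /minsetP[/forall_inP hitX minX] sXF] := minset_exists hF.
exists X; split=> // [i Qi | x Xx].
  by have /set0Pn[x /setIP[]] := hitX i Qi; exists x.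
have /forall_inPn[i Qi] : ~~ hit (X :\ x).
  apply/negP=> /minX/(_ (subD1set _ _)) eqX.
  by move: Xx; rewrite -eqX !inE eqxx.
rewrite negbK => /eqP AX0; exists i => // y Xy.
have [-> | neq_yx] := eqVneq y x.
  have /set0Pn[z /setIP[Az Xz]] := hitX i Qi.
  have [<- | neq_zx] := eqVneq z x; first by rewrite Az.
  by have := in_set0 z; rewrite -AX0 !inE Az neq_zx Xz.
by have := in_set0 y; rewrite -AX0 !inE neq_yx Xy !andbT => ->.
Qed.

(** The inductive step: [F] holds the uncoloured points and [X] becomes a colour class. Only the
    uniform bound [m] is tracked, since in the dual case a non-minimal set may lose more than two
    points. *)
Definition cheap_transversals : Prop :=
  forall (F : {set T}) m, (forall i, m.+2 <= #|A i :&: F|) ->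
  exists X : {set T},
    [/\ X \subset F, forall i, exists2 x, x \in X & x \in A i
      & forall i, m <= #|A i :&: (F :\: X)|].

Lemma leq_card_setI_setD (B F X : {set T}) m :
  m.+2 <= #|B :&: F| -> #|B :&: X| <= 2 -> m <= #|B :&: (F :\: X)|.
Proof.
move=> leF leX; rewrite setIDA -(leq_add2l 2).
apply: leq_trans leF _; rewrite -(cardsID X) leq_add2r.
by apply: leq_trans leX; rewrite subset_leq_card // setIAC subsetIl.
Qed.

(** Each colour costs two points of the guaranteed size, except the last, which needs one point in
    every set: hence 2k + 1 for k + 1 colours. *)
Lemma polychromatic_of_cheap_transversals (F : {set T}) k :
    cheap_transversals -> (forall i, k.*2.+1 <= #|A i :&: F|) ->
  exists c : T -> 'I_k.+1,
    forall i j, exists2 x, x \in A i :&: F & c x = j.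
Proof.
move=> step; elim: k F => [|k IHk] F leF.
  exists (fun=> ord0) => i j; rewrite (ord1 j).
  by have /card_gt0P[x] := leF i; exists x.
have [X [sXF hitX /IHk[c cP]]] := step F k.*2.+1 leF.
exists (fun x => if x \in X then ord0 else lift ord0 (c x)) => i j.
case: (unliftP ord0 j) => [j' -> | ->].
  have [x] := cP i j'; rewrite !inE => /and3P[Ax /negPf X'x Fx] <-.
  by exists x; rewrite ?X'x // inE Ax Fx.
have [x Xx Ax] := hitX i.
by exists x; rewrite ?Xx // inE Ax (subsetP sXF).
Qed.

Lemma cheap_transversals_points :
    (forall x y, x != y ->
       exists b, forall i, (x \in A i, y \in A i) != b) ->
  cheap_transversals.
Proof.
move=> vcA F m leF.
have [i _ | X [sXF hitX privX]] := @minimal_transversal xpredT F.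
  by rewrite -card_gt0 (leq_trans _ (leF i)).
exists X; split=> // i; first exact: hitX.
apply: leq_card_setI_setD => //; rewrite leqNgt; apply/card_gt2P.
case=> x [y [z [[]]]].
move=> /setIP[Ax Xx] /setIP[Ay Xy] /setIP[_ Xz] [neq_xy neq_yz neq_zx].
have [ix _ ixP] := privX x Xx; have [iy _ iyP] := privX y Xy.
have [iz _ izP] := privX z Xz.
(* All four traces on [x] and [y] occur: both points lie in [A i], exactly one in each of [A ix] and
   [A iy], none in [A iz]. *)
have [[[] []] bP] := vcA x y neq_xy.
- by have := bP i; rewrite Ax Ay.
- by have := bP ix; rewrite !ixP // eqxx (eq_sym y) (negPf neq_xy).
- by have := bP iy; rewrite !iyP // eqxx (negPf neq_xy).
- by have := bP iz; rewrite !izP // (eq_sym x) (negPf neq_zx) (negPf neq_yz).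
Qed.

(** Within [F], every set contains a minimal one, from which it inherits a point of [X] and the
    bound on what remains. So only minimal sets must meet [X] in at most two points. *)
Lemma cheap_transversals_sets :
    (forall i j, i != j ->
       exists b, forall x, (x \in A i, x \in A j) != b) ->
  cheap_transversals.
Proof.
move=> vcA F m leF.
pose minimal i := [forall j, ~~ (A j :&: F \proper A i :&: F)].
have ex_minimal i : exists2 j, minimal j & A j :&: F \subset A i :&: F.
  pose below j := A j :&: F \subset A i :&: F.
  case: (@arg_minnP _ i below (fun j => #|A j :&: F|)) => [|j sji minj].
    exact: subxx.
  exists j => //; apply/forallP=> l; apply/negP=> plj.
  have := minj l (subset_trans (proper_sub plj) sji).
  by rewrite leqNgt proper_card.
have [i _ | X [sXF hitX privX]] := @minimal_transversal minimal F.
  by rewrite -card_gt0 (leq_trans _ (leF i)).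
exists X; split=> // i; have [j minj sji] := ex_minimal i.
  have [x Xx Ax] := hitX j minj; exists x => //.
  have /(subsetP sji)/setIP[] // : x \in A j :&: F.
  by rewrite inE Ax (subsetP sXF).
suff leX : #|A j :&: X| <= 2.
  apply: leq_trans (leq_card_setI_setD (leF j) leX) (subset_leq_card _).
  by rewrite !setIDA setSD.
rewrite leqNgt; apply/card_gt2P=> -[x [y [z [[]]]]].
move=> /setIP[Ax Xx] /setIP[Ay Xy] /setIP[_ Xz] [neq_xy neq_yz neq_zx].
have [ix _ ixP] := privX x Xx; have [iy _ iyP] := privX y Xy.
(* By minimality of [j], the trace of [A l] on [F] is not properly inside that of [A j]; as [A l]
   misses the point [w] of [A j], it must leave [A j]. *)
have out l w : w \in X -> w \in A j -> w \notin A l ->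
    exists2 u, u \in A l & u \notin A j.
  move=> Xw Aw A'w; have := forallP minj l.
  have Fw := subsetP sXF w Xw.
  case: (boolP (A l :&: F \subset A j :&: F)) => [slj | /subsetPn[u]].
    rewrite properE slj negbK => /subsetP/(_ w).
    by rewrite !inE Aw Fw (negPf A'w) => /(_ isT).
  by rewrite !inE => /andP[Au ->]; rewrite andbT => A'u _; exists u.
have A'yx : y \notin A ix by rewrite ixP // eq_sym.
have A'xy : x \notin A iy by rewrite iyP.
have Axx : x \in A ix by rewrite ixP.
have Ayy : y \in A iy by rewrite iyP.
(* The points [x], [y], [w] lie in both sets, in [A j] only and in [A ix] only, so the missing
   pattern is a point outside both. *)
have cover_jx u : u \notin A j -> u \in A ix.
  move=> A'ju; apply: contraT => A'xu.
  have [|b bP] := vcA j ix; first by apply: contraNneq A'yx => <-.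
  have [w Aw A'w] := out ix y Xy Ay A'yx.
  move: bP; case: b => [[] []] bP.
  - by have := bP x; rewrite Ax Axx.
  - by have := bP y; rewrite Ay (negPf A'yx).
  - by have := bP w; rewrite Aw (negPf A'w).
  - by have := bP u; rewrite (negPf A'ju) (negPf A'xu).
(* The points [x], [y], [z] lie in [A ix] only, in [A iy] only and in neither, so the missing
   pattern is a common point. *)
have disj_xy u : u \in A ix -> u \notin A iy.
  move=> Axu; apply/negP=> Ayu.
  have [|b bP] := vcA ix iy; first by apply: contraNneq A'yx => ->.
  move: bP; case: b => [[] []] bP.
  - by have := bP u; rewrite Axu Ayu.
  - by have := bP x; rewrite Axx (negPf A'xy).
  - by have := bP y; rewrite Ayy (negPf A'yx).
  - have := bP z; rewrite ixP // iyP // (negPf neq_zx).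
    by rewrite (eq_sym z) (negPf neq_yz).
have [u Au /cover_jx/disj_xy] := out iy x Xx Ax A'xy.
by rewrite Au.
Qed.

End Transversals.

(** * Consequences of VC-dimension one *)

Section VCDimensionOne.

Variables (H : hypergraph) (vcH : vc_dim H = 1).

(** If all four patterns occurred, the pair would be shattered. This feeds both transversal lemmas:
    directly for hyperedges, and with incidence reversed for the dual family. *)
Lemma vc_dim1_missing_trace (x y : vertex H) : x != y ->
  exists b, forall e : edge_index H, (x \in edge e, y \in edge e) != b.
Proof.
move=> neq_xy.
case: (boolP [exists b, forall e : edge_index H,
                (x \in edge e, y \in edge e) != b]) => [/existsP[b /forallP]|].
  by exists b.
rewrite negb_exists => /forallP all_traces.
suff sh : shattered [set x; y].
  have : #|[set x; y]| <= vc_dim H by apply: leq_bigmax_cond.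
  by rewrite vcH cards2 neq_xy.
rewrite /shattered eqEsubset; apply/andP; split; apply/subsetP=> B.
  by case/imsetP=> e _ ->; rewrite powersetE subsetIl.
rewrite powersetE => sB.
have /forallPn[e] := all_traces (x \in B, y \in B).
rewrite negbK => /eqP[ex ey]; apply/imsetP; exists e => //.
apply/setP=> z; rewrite !inE.
have [-> | neq_zx] /= := eqVneq z x; first by rewrite ex.
have [-> | neq_zy] /= := eqVneq z y; first by rewrite ey.
by apply/negP=> /(subsetP sB); rewrite !inE (negPf neq_zx) (negPf neq_zy).
Qed.

(** Excludes degenerate cases: a hyperedge bounds the number of vertex colours, and a vertex makes
    all colour classes of hyperedges nonempty. *)
Lemma vc_dim1_incidence :
  exists v : vertex H, exists e : edge_index H, v \in edge e.
Proof.
have [S shS /card_gt0P[v Sv]] :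
    exists2 S : {set vertex H}, shattered S & 0 < #|S|.
  apply/exists_inP; apply: contraT => /exists_inPn noS.
  suff : vc_dim H <= 0 by rewrite vcH.
  by apply/bigmax_leqP => S /noS; rewrite -leqNgt.
have : S \in powerset S by rewrite powersetE.
rewrite -(eqP shS) => /imsetP[e _ eqS]; exists v, e.
by move: Sv; rewrite eqS => /setIP[].
Qed.

End VCDimensionOne.

(** * Lower bounds on the two colouring numbers *)

Lemma bounded_maximum (P : nat -> Prop) (p : pred nat) n b :
    (forall k, reflect (P k) (p k)) -> P n -> (forall k, P k -> k <= b) ->
  exists2 m, is_maximum P m & n <= m.
Proof.
move=> pP Pn leb.
have exp : exists k, p k by exists n; apply/pP.
have lepb k : p k -> k <= b by move/pP/leb.
case: (ex_maxnP exp lepb) => m /pP Pm maxm.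
exists m; last by apply/maxm/pP.
by split=> // k /pP/maxm.
Qed.

Lemma leq_card_fibres (T : finType) k (c : T -> 'I_k) m :
  (forall i, m <= #|[set x | c x == i]|) -> k * m <= #|T|.
Proof.
move=> lem; rewrite -[k in k * m]card_ord -sum_nat_const -sum1_card.
rewrite (partition_big c xpredT) //=; apply: leq_sum => i _.
by rewrite sum1dep_card lem.
Qed.

Lemma leq_uphalf_of_mul2 k n : k * 2 <= n.+1 -> k <= uphalf n.
Proof. by rewrite muln2 => lek; rewrite -[uphalf n]/(n.+1./2) geq_half_double. Qed.

Lemma polychromatic_number_geq (H : hypergraph) r :
    1 <= r -> vc_dim H = 1 -> (forall e : edge_index H, r <= #|edge e|) ->
  exists2 p, is_polychromatic_number H p & uphalf r <= p.
Proof.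
case: r => // r _ vcH ler.
(* Finite functions make colourability decidable, as [bounded_maximum] requires. *)
pose polyb k := [exists c : {ffun vertex H -> 'I_k},
  [forall e : edge_index H, forall i, exists v in edge e, c v == i]].
apply: (@bounded_maximum _ polyb _ #|vertex H|) => [k||k [c cP]].
- apply: (iffP existsP) => -[c cP].
    exists c => e i; have /forallP/(_ i)/exists_inP[v ev /eqP cv] :=
      forallP cP e.
    by exists v.
  exists (finfun c); apply/forallP=> e; apply/forallP=> i.
  have [v ev cv] := cP e i; apply/exists_inP; exists v => //.
  by rewrite ffunE cv.
(* The size bound is now [r.+1]: the [r./2.+1] colours, which is [uphalf r.+1], need [r./2.*2.+1]
   points, at most [r.+1]. *)
- have [|e|c cP] := @polychromatic_of_cheap_transversals _ _ (@edge H) setT r./2.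
  + apply: cheap_transversals_points => x y; exact: vc_dim1_missing_trace.
  + by rewrite setIT (leq_trans _ (ler e)) // ltnS -[leqRHS]odd_double_half leq_addl.
  + exists c => e i; have [v] := cP e i.
    by rewrite setIT; exists v.
- have [v [e _]] := vc_dim1_incidence vcH.
  rewrite -[k]muln1; apply: (@leq_card_fibres _ _ c) => i.
  by have [w _ cw] := cP e i; apply/card_gt0P; exists w; rewrite inE cw.
Qed.

(** The blocks are the colour classes; [v0] lies in a hyperedge of every colour, so they are
    nonempty and distinct. *)
Lemma cover_decomposable_colouring (H : hypergraph) k
    (c : edge_index H -> 'I_k) (v0 : vertex H) :
    (forall v i, exists2 e : edge_index H, v \in edge e & c e = i) ->
  cover_decomposable H k.
Proof.
move=> cP; pose fibre i := [set e | c e == i].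
have inj_fibre : injective fibre.
  move=> i j /setP eqF; have [e _ ce] := cP v0 i.
  by have := eqF e; rewrite !inE ce eqxx => /esym/eqP.
exists [set fibre i | i : 'I_k]; split.
- apply/and3P; split.
  + apply/eqP/setP=> e; rewrite inE; apply/bigcupP; exists (fibre (c e)).
      exact: imset_f.
    by rewrite inE.
  + apply/trivIsetP=> _ _ /imsetP[i _ ->] /imsetP[j _ ->] neqF.
    apply/pred0P=> e /=; rewrite !inE; apply/negP=> /andP[/eqP ci /eqP cj].
    by rewrite -ci -cj eqxx in neqF.
  + apply/imsetP=> -[i _ eq0]; have [e _ ce] := cP v0 i.
    by have := in_set0 e; rewrite eq0 inE ce eqxx.
- by rewrite card_imset // card_ord.
- move=> _ /imsetP[i _ ->]; apply/eqP/setP=> v; rewrite inE.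
  by have [e ev ce] := cP v i; apply/bigcupP; exists e; rewrite // inE ce.
Qed.

Lemma cover_decomposition_number_geq (H : hypergraph) delta :
    1 <= delta -> vc_dim H = 1 -> (forall v : vertex H, delta <= degree v) ->
  exists2 p, is_cover_decomposition_number H p & uphalf delta <= p.
Proof.
case: delta => // d _ vcH led; have [v0 _] := vc_dim1_incidence vcH.
pose decb k := [exists P : {set {set edge_index H}},
  [&& partition P setT, #|P| == k & [forall (C | C \in P), set_cover C]]].
apply: (@bounded_maximum _ decb _ #|edge_index H|) => [k||k [P [partP <- _]]].
- apply: (iffP existsP) => -[P].
    by case/and3P=> partP /eqP cardP /forall_inP coverP; exists P.
  by case=> partP /eqP cardP coverP; exists P; apply/and3P; split=> //;
    apply/forall_inP.
(* In the dual family, a colouring of the hyperedges in which every [A v] sees all colours has set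
   covers as colour classes. *)
- pose A (v : vertex H) := [set e : edge_index H | v \in edge e].
  have [|v|c cP] := @polychromatic_of_cheap_transversals _ _ A setT d./2.
  + apply: cheap_transversals_sets => x y neq_xy.
    have [b bP] := vc_dim1_missing_trace vcH neq_xy.
    by exists b => e; rewrite !inE.
  + by rewrite setIT (leq_trans _ (led v)) // ltnS -[leqRHS]odd_double_half leq_addl.
  + apply: (cover_decomposable_colouring (c := c) v0) => v i.
    by have [e] := cP v i; rewrite setIT inE; exists e.
- rewrite -cardsT (card_partition partP) -sum1_card; apply: leq_sum => C PC.
  rewrite card_gt0; apply: contraTneq PC => ->.
  by case/and3P: partP.
Qed.

(** * Sharpness: complements of singletons *)

Definition cosingletons n : hypergraph :=
  @Hypergraph 'I_n 'I_n (fun x => [set~ x]).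

Lemma vc_dim_cosingletons n : vc_dim (cosingletons n.+2) = 1.
Proof.
apply/eqP; rewrite eqn_leq; apply/andP; split.
  apply/bigmax_leqP=> S /eqP shS.
  have : set0 \in powerset S by rewrite powersetE sub0set.
  rewrite -shS => /imsetP[/= e _ eq0].
  (* The empty trace is cut out by the complement of [e], which confines [S] to that single
     point. *)
  suff sS : S \subset [set e] by rewrite -(cards1 e) subset_leq_card.
  by rewrite -setD_eq0 setDE -eq0.
rewrite -(cards1 (ord0 : vertex (cosingletons n.+2))).
apply: leq_bigmax_cond; rewrite /shattered eqEsubset; apply/andP; split.
  by apply/subsetP=> _ /imsetP[e _ ->]; rewrite powersetE subsetIl.
apply/subsetP=> B; rewrite powersetE subset1 => /orP[] /eqP ->.
  apply/imsetP; exists (ord_max : 'I_n.+2) => //=.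
  by apply/setP=> x; rewrite !inE; have [->|] := eqVneq x ord0.
by apply/imsetP; exists (ord0 : 'I_n.+2) => //=; rewrite setICr.
Qed.

(** A colour used on one vertex only would be absent from the hyperedge omitting it, so each class
    has at least two vertices. *)
Lemma polychromatic_cosingletons n k (c : vertex (cosingletons n.+2) -> 'I_k) :
  polychromatic c -> k * 2 <= n.+2.
Proof.
move=> cP; rewrite -[leqRHS]card_ord; apply: (leq_card_fibres (c := c)) => i.
have [v _ cv] := cP (ord0 : 'I_n.+2) i; have [w /= wv cw] := cP v i.
by apply/card_gt1P; exists w, v; move: wv; rewrite !inE cv cw eqxx.
Qed.

(** The hyperedge [e] omits the vertex [e], so each cover needs a second hyperedge. *)
Lemma cover_decomposable_cosingletons n k :
  cover_decomposable (cosingletons n.+2) k -> k * 2 <= n.+2.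
Proof.
case=> P [partP <- coverP].
rewrite -[leqRHS]card_ord -cardsT (card_partition partP) -sum_nat_const.
apply: leq_sum => C /coverP/eqP/setP covC.
have := covC (ord0 : 'I_n.+2); rewrite inE => /bigcupP[/= e Ce _].
have := covC e; rewrite inE => /bigcupP[/= f Cf].
by rewrite !inE => neq_ef; apply/card_gt1P; exists e, f.
Qed.

Lemma edge_cosingletons n (e : edge_index (cosingletons n.+2)) :
  n.+1 <= #|edge e|.
Proof. by rewrite cardsC1 card_ord. Qed.

Lemma degree_cosingletons n (v : vertex (cosingletons n.+2)) :
  n.+1 <= degree v.
Proof.
rewrite /degree (_ : [set _ | _] = [set~ v]) ?cardsC1 ?card_ord //.
by apply/setP=> e; rewrite !inE eq_sym.
Qed.

Theorem theorem6 :
  (forall r : nat, 1 <= r ->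
     (forall H : hypergraph, vc_dim H = 1 ->
        (forall e : edge_index H, r <= #|edge e|) ->
        exists2 p : nat, is_polychromatic_number H p & uphalf r <= p) /\
     (exists H : hypergraph,
        [/\ vc_dim H = 1,
            forall e : edge_index H, r <= #|edge e|
          & is_polychromatic_number H (uphalf r)])) /\
  (forall delta : nat, 1 <= delta ->
     (forall H : hypergraph, vc_dim H = 1 ->
        (forall v : vertex H, delta <= degree v) ->
        exists2 p' : nat,
          is_cover_decomposition_number H p' & uphalf delta <= p') /\
     (exists H : hypergraph,
        [/\ vc_dim H = 1,
            forall v : vertex H, delta <= degree v
          & is_cover_decomposition_number H (uphalf delta)])).
Proof.
split=> -[|n] // _; split.
- by move=> H; apply: polychromatic_number_geq.
- exists (cosingletons n.+2).
  split; [exact: vc_dim_cosingletons | exact: edge_cosingletons |].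
  have [//|||p maxp lep] := @polychromatic_number_geq (cosingletons n.+2) n.+1.
  + exact: vc_dim_cosingletons.
  + exact: edge_cosingletons.
  + suff -> : uphalf n.+1 = p by [].
    apply/eqP; rewrite eqn_leq lep; apply: leq_uphalf_of_mul2.
    by case: maxp => -[c /polychromatic_cosingletons].
- by move=> H; apply: cover_decomposition_number_geq.
- exists (cosingletons n.+2).
  split; [exact: vc_dim_cosingletons | exact: degree_cosingletons |].
  have [//|||p maxp lep] :=
    @cover_decomposition_number_geq (cosingletons n.+2) n.+1.
  + exact: vc_dim_cosingletons.
  + exact: degree_cosingletons.
  + suff -> : uphalf n.+1 = p by [].
    apply/eqP; rewrite eqn_leq lep; apply: leq_uphalf_of_mul2.
    by case: maxp => /cover_decomposable_cosingletons.
Qed.
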